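(* Let $I$ be a compact interval and let $f : I \to I$ be a continuous map. If $f$ has a periodic point of least period $m$ for some integer $m > 2$, then $f$ also has a periodic point of least period $2$.
   Context: For $n \ge 1$, $f^n$ denotes the $n$-fold iterate of $f$ (so $f^1 = f$, $f^n = f \circ f^{n-1}$ for $n \ge 2$). A point $y \in I$ is a periodic point of $f$ with least period $m$ if $f^m(y) = y$ and $f^i(y) \ne y$ for all $0 < i < m$. *)

(* Defs.v *)
From mathcomp Require Import all_boot.

Set Implicit Arguments.
Unset Strict Implicit.
Unset Printing Implicit Defensive.

(* Membership of y in the domain I of f is a separate hypothesis wherever this
   is used with an f : R -> R that represents a self-map of I. The condition
   0 < m is needed because iter 0 f y = y holds for every y. *)
Definition has_least_period (T : Type) (f : T -> T) (m : nat) (y : T) : Prop :=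
  [/\ 0 < m, iter m f y = y & forall i : nat, 0 < i < m -> iter i f y <> y].

(* Main.v *)
Require Import Defs.
From mathcomp Require Import all_boot all_order all_algebra.
From mathcomp Require Import all_classical all_reals all_analysis.
Import Order.TTheory GRing.Theory Num.Theory.
Import numFieldNormedType.Exports.
Local Open Scope classical_set_scope.
Local Open Scope ring_scope.

Set Implicit Arguments.
Unset Strict Implicit.
Unset Printing Implicit Defensive.

(** The heart of the matter is a configuration p < v < f v with
    f (f v) <= p < f (f p): such a triple forces a point of least period 2
    (lemma least_period2_of_escape).  Indeed f^2 moves v to the left, so any
    w < v that f^2 moves to the right gives a fixed point of f^2 in [w, v]; to
    be sure that it is not a fixed point of f, w must be chosen so that f lies
    above the diagonal on [w, v].
    - If f lies above the diagonal on the whole of [p, v], take w := p.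
    - Otherwise let u be the last point of [p, v] at which f is not above the
      diagonal.  On [u, v] the values of f sweep from f u <= u to f v, hence
      reach a fixed point q of f that lies between v and f v.  A point w with
      f w = q works, since f^2 w = q > v >= w, and w > u.

    A periodic orbit with more than two points provides the configuration
    (lemma least_period_escape).  Take for p its minimum and for b the point of
    the orbit that f sends to p.  The orbit starts at p < b and comes to b, so
    some orbit point x < b has f x >= b; as f b = p < b, there is v in [x, b]
    with f v = b, and then f (f v) = p.  Neither v = p nor f (f p) = p can
    occur, because p is not fixed by f^2.

    All this is done for maps that are continuous on the whole line; a self-map
    of [a, b] is reduced to that case by composing it with the retraction of
    the line onto [a, b], which changes neither the orbits in [a, b] nor, since
    the extended map takes its values in [a, b], the set of periodic points. *)

(** * Fixed points and crossings of the diagonal *)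

Lemma continuous_subr_id (R : realType) (f : R -> R) :
  continuous f -> continuous (fun x => f x - x).
Proof. by move=> cf x; apply: cvgB; [exact: cf | exact: cvg_id]. Qed.

Lemma fixed_point_between (R : realType) (f : R -> R) (x y : R) :
  continuous f -> x <= y -> x <= f x -> f y <= y ->
  exists2 q, x <= q <= y & f q = q.
Proof.
move=> cf xy fx fy.
have [|q] := IVT (v := 0) xy (continuous_subspaceT (continuous_subr_id cf)).
  by rewrite ge_min le_max !subr_le0 !subr_ge0 fx fy orbT.
by rewrite in_itv /= => qxy /eqP; rewrite subr_eq0 => /eqP fq; exists q.
Qed.

(** The set of points of [p, v] where f is not above the diagonal is closed, so
    it contains its supremum. *)
Lemma last_below_diagonal (R : realType) (f : R -> R) (p x v : R) :
  continuous f -> p <= x <= v -> f x <= x ->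
  exists u, [/\ p <= u <= v, f u <= u & forall t, u < t <= v -> t < f t].
Proof.
move=> cf xpv fx.
pose S := [set t | p <= t <= v] `&` [set t | f t - t <= 0].
have Sx : S x by split=> //=; rewrite subr_le0.
have ubS : ubound S v by move=> t [/andP[]].
have clS : closed S.
  apply: closedI.
    have -> : [set t : R | p <= t <= v] = [set` `[p, v]].
      by apply/seteqP; split=> t /=; rewrite in_itv.
    exact: interval_closed.
  apply: (@closed_comp _ _ (fun t => f t - t) [set t : R | t <= 0]).
    by move=> t _; exact: continuous_subr_id.
  exact: closed_le.
have [supS1 supS2] : S (sup S).
  by rewrite [X in X (sup _)](closure_id S).1//; apply: closure_sup;
     [exists x | exists v].
exists (sup S); split=> //; first by rewrite -subr_le0.
move=> t /andP[supt tv]; rewrite ltNge; apply/negP => ft.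
have : t <= sup S.
  apply: ub_le_sup; first by exists v.
  split=> /=; last by rewrite subr_le0.
  by rewrite tv andbT (le_trans _ (ltW supt)) //; case/andP: supS1.
by rewrite leNgt supt.
Qed.

(** * Points of least period 2 *)

Lemma least_period2P (T : Type) (f : T -> T) (x : T) :
  f (f x) = x -> f x <> x -> has_least_period f 2 x.
Proof. by move=> ffx fx; split=> // -[|[|i]]. Qed.

Lemma least_period2_above_diagonal (R : realType) (f : R -> R) (w v : R) :
  continuous f -> w <= v -> (forall t, w <= t <= v -> t < f t) ->
  w <= f (f w) -> f (f v) <= v -> exists z, has_least_period f 2 z.
Proof.
move=> cf wv above ffw ffv.
have cff : continuous (f \o f).
  by move=> t; apply: continuous_comp; exact: cf.
have [z zwv ffz] := fixed_point_between cff wv ffw ffv.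
exists z; apply: least_period2P => // fz.
by have := above z zwv; rewrite fz ltxx.
Qed.

Lemma least_period2_of_escape (R : realType) (f : R -> R) (p v : R) :
  continuous f -> p < v -> v < f v -> f (f v) <= p -> p < f (f p) ->
  exists z, has_least_period f 2 z.
Proof.
move=> cf pv vfv ffv ffp.
have ffvv : f (f v) <= v by rewrite (le_trans ffv) // ltW.
have [[x xpv fx]|above] := pselect (exists2 x, p <= x <= v & f x <= x); last first.
  apply: (least_period2_above_diagonal cf (ltW pv) _ (ltW ffp) ffvv) => t tpv.
  by rewrite ltNge; apply/negP => ft; apply: above; exists t.
have [u [/andP[pu uv] fu above]] := last_below_diagonal cf xpv fx.
have [q /andP[vq qfv] fq] : exists2 q, v <= q <= f v & f q = q.
  apply: fixed_point_between cf (ltW vfv) (ltW vfv) _.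
  exact: le_trans ffvv (ltW vfv).
have vltq : v < q.
  by rewrite lt_neqAle vq andbT; apply: contraTneq vfv => ->; rewrite fq ltxx.
have [|w wuv fw] := IVT (v := q) uv (continuous_subspaceT cf).
  by rewrite ge_min le_max qfv orbT (le_trans fu) // (le_trans uv).
move: wuv; rewrite in_itv /= => /andP[uw wv].
have ultw : u < w.
  rewrite lt_neqAle uw andbT; apply: contraTneq fu => ->.
  by rewrite fw -ltNge (le_lt_trans wv).
apply: (least_period2_above_diagonal cf wv _ _ ffvv) => [t /andP[wt tv]|].
  by apply: above; rewrite (lt_le_trans ultw wt).
by rewrite fw fq (le_trans wv).
Qed.

(** * Periodic orbits *)

Lemma has_least_period_iter (T : Type) (f : T -> T) (m k : nat) (y : T) :
  (k <= m)%N -> has_least_period f m y -> has_least_period f m (iter k f y).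
Proof.
move=> km [m0 fm fi]; split=> // [|i im]; first by rewrite -iterD addnC iterD fm.
(* Applying f another m - k times brings the orbit back to y. *)
move=> /(congr1 (iter (m - k) f)); rewrite -!iterD addnAC subnK // addnC iterD fm.
exact: fi.
Qed.

Lemma least_period_orbit_min (R : realType) (f : R -> R) (m : nat) (y : R) :
  has_least_period f m y ->
  exists2 p, has_least_period f m p & forall j, p <= iter j f p.
Proof.
move=> per; have [m0 fm _] := per.
pose k := [arg min_(i < Ordinal m0) iter i f y]%O.
have kmin j : iter k f y <= iter j f y.
  have fmq q : iter (q * m) f y = y.
    by elim: q => // q IHq; rewrite mulSn iterD IHq.
  rewrite (divn_eq j m) addnC iterD fmq /k.
  by case: arg_minP => // i _ /(_ (Ordinal (ltn_pmod j m0)) isT).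
exists (iter k f y) => [|j]; last by rewrite -iterD.
exact: has_least_period_iter (ltnW (ltn_ord k)) per.
Qed.

(** A discrete intermediate value principle; on an orbit it locates an interval
    to which the continuous one applies. *)
Lemma crossing_step (R : realType) (s : nat -> R) (b : R) (n : nat) :
  s 0%N < b -> b <= s n -> exists i, s i < b <= s i.+1.
Proof.
move=> s0; elim: n => [|n IHn sn]; first by rewrite leNgt s0.
by have [/IHn//|snb] := leP b (s n); exists n; rewrite snb.
Qed.

Lemma least_period_escape (R : realType) (f : R -> R) (m : nat) (p : R) :
  continuous f -> (2 < m)%N -> has_least_period f m p ->
  (forall j, p <= iter j f p) ->
  exists v, [/\ p < v, v < f v, f (f v) <= p & p < f (f p)].
Proof.
move=> cf m2 [m0 fm fi] pmin.
have ffp : f (f p) <> p by apply: (fi 2%N).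
pose b := iter m.-1 f p.
have fb : f b = p by rewrite -iterS prednK.
have pb : p < b.
  rewrite lt_neqAle pmin andbT; apply/eqP => pb.
  by apply: ffp; rewrite [in LHS]pb fb [in LHS]pb fb.
have [i /andP[xb bfx]] := crossing_step (s := fun j => iter j f p) pb (lexx b).
have [|v] := IVT (v := b) (ltW xb) (continuous_subspaceT cf).
  by rewrite ge_min le_max bfx fb (ltW pb) orbT.
rewrite in_itv /= => /andP[xv vb] fv.
have pv : p < v.
  rewrite lt_neqAle (le_trans (pmin i)) // andbT; apply/eqP => pv.
  by apply: ffp; rewrite [in LHS]pv fv.
exists v; rewrite fv fb; split=> //.
  rewrite lt_neqAle vb andbT; apply: contraTneq pb => vb'.
  by rewrite -{1}fb -{1}vb' fv ltxx.
by rewrite lt_neqAle (pmin 2%N) andbT eq_sym; apply/eqP.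
Qed.

Lemma continuous_least_period2 (R : realType) (f : R -> R) (m : nat) (y : R) :
  continuous f -> (2 < m)%N -> has_least_period f m y ->
  exists z, has_least_period f 2 z.
Proof.
move=> cf m2 /least_period_orbit_min[p per pmin].
have [v [pv vfv ffv ffp]] := least_period_escape cf m2 per pmin.
exact: least_period2_of_escape cf pv vfv ffv ffp.
Qed.

(** * Extension of a self-map of a segment to the line *)

Definition clamp (R : realType) (a b x : R) : R := Num.max a (Num.min b x).

Lemma clamp_in (R : realType) (a b x : R) :
  a <= b -> clamp a b x \in `[a, b].
Proof. by move=> ab; rewrite in_itv /= le_max lexx ge_max ab ge_min lexx. Qed.

Lemma clamp_id (R : realType) (a b x : R) :
  x \in `[a, b] -> clamp a b x = x.
Proof.
by rewrite in_itv /= => /andP[ax xb]; rewrite /clamp (min_idPr xb) (max_idPr ax).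
Qed.

Lemma continuous_clamp (R : realType) (a b : R) : continuous (clamp a b).
Proof.
move=> x; apply: (@continuous_max R R (cst a)); first exact: cvg_cst.
by apply: (@continuous_min R R (cst b)); [exact: cvg_cst | exact: cvg_id].
Qed.

Lemma continuous_comp_clamp (R : realType) (a b : R) (f : R -> R) :
  a <= b -> {within `[a, b], continuous f} -> continuous (f \o clamp a b).
Proof.
move=> ab /subspace_continuousP cf x.
have clampx : [set` `[a, b]] (clamp a b x) by exact: clamp_in.
apply: (cvg_comp (clamp a b) f _ (cf _ clampx)) => W /continuous_clamp clampW.
by apply: (@filterS _ (nbhs x)) clampW => t /=; apply; exact: clamp_in.
Qed.

Theorem proposition3 (R : realType) (a b : R) (hab : a <= b) (f : R -> R)
    (f_maps : forall x : R, x \in `[a, b] -> f x \in `[a, b])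
    (f_cont : {within `[a, b], continuous f})
    (m : nat) (hm : (2 < m)%N)
    (hper : exists y : R, y \in `[a, b] /\ has_least_period f m y) :
  exists z : R, z \in `[a, b] /\ has_least_period f 2 z.
Proof.
have cg := continuous_comp_clamp hab f_cont.
set g := f \o clamp a b in cg.
have gE x : x \in `[a, b] -> g x = f x by move=> xab; rewrite /g /= clamp_id.
have gab x : g x \in `[a, b] by exact/f_maps/clamp_in.
have [y [yab [m0 fm fi]]] := hper.
have iter_g i : iter i g y = iter i f y /\ iter i f y \in `[a, b].
  elim: i => // i [/= -> IHi]; split; [exact: gE | exact: f_maps].
have per_g : has_least_period g m y.
  by split=> // [|i im]; rewrite (iter_g _).1 //; exact: fi.
have [z [_ /= ggz gz]] := continuous_least_period2 cg hm per_g.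
have zab : z \in `[a, b] by rewrite -ggz.
exists z; split=> //; apply: least_period2P.
  by rewrite -(gE z zab) -(gE _ (gab z)).
by rewrite -(gE z zab); exact: (gz 1%N).
Qed.
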